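(* Let $\star$ be a semistar operation defined on an integral domain $D$ with quotient field $K$, and let $X$ be an indeterminate over $K$. Put $D_1:=D[X]$, $K_1:=K(X)$, let $Y$ be an indeterminate over $K_1$, and set $$\Delta_{1}:=\{Q_1\in\mathrm{Spec}(D_1)\mid\text{either }Q_1\cap D=(0)\text{ or }(Q_1\cap D)^{\star_f}\subsetneq D^{\star_f}\},$$ $$\Delta'_{1}:=\{Q_1\in\mathrm{Spec}(D_1)\mid\text{either }Q_1\cap D=(0),\text{ or }Q_1=(Q_1\cap D)[X]\text{ and }(Q_1\cap D)^{\star_f}\subsetneq D^{\star}\},$$ $$\mathcal S^\sharp_{1}:=D_1[Y]\setminus\bigcup\{Q_1[Y]\mid Q_1\in\Delta_{1}\},\qquad\mathcal S'_{1}:=D_1[Y]\setminus\bigcup\{Q_1[Y]\mid Q_1\in\Delta'_{1}\}.$$ Let $\star_1$ and $\star'_1$ be the stable semistar operations of finite type on $D[X]$ defined, for $A\in\overline{\boldsymbol F}(D_1)$, by $$A^{\star_1}:=A\,D_1[Y]_{\mathcal S^\sharp_{1}}\cap K_1,\qquad A^{\star'_1}:=A\,D_1[Y]_{\mathcal S'_{1}}\cap K_1.$$ Then: (1) $[\widetilde\star]=\star_1\le\star'_1$. (2) $\star'_1=\langle\widetilde\star\rangle$.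
   Context: For an integral domain $R$ with quotient field $L$: $\overline{\boldsymbol F}(R)$ is the set of nonzero $R$-submodules of $L$ and $\boldsymbol f(R)$ the set of nonzero finitely generated ones. A semistar operation on $R$ is a map $\star:\overline{\boldsymbol F}(R)\to\overline{\boldsymbol F}(R)$, $E\mapsto E^\star$, such that for all $0\ne x\in L$ and $E,F\in\overline{\boldsymbol F}(R)$: $(xE)^\star=xE^\star$; $E\subseteq F$ implies $E^\star\subseteq F^\star$; $E\subseteq E^\star=(E^\star)^\star$. Write $\star'\le\star''$ if $E^{\star'}\subseteq E^{\star''}$ for all $E$. $E^{\star_f}:=\bigcup\{F^\star\mid F\in\boldsymbol f(R),F\subseteq E\}$; $\star$ is of finite type if $\star=\star_f$; $\star$ is stable if $(E\cap F)^\star=E^\star\cap F^\star$ for all $E,F$. A nonzero ideal $I$ of $R$ is a quasi-$\star$-ideal if $I^\star\cap R=I$; $\mathrm{QMax}^\star(R)$ is the set of maximal elements among proper quasi-$\star$-ideals (these are prime). $\widetilde\star$ denotes the semistar operation $E^{\widetilde\star}:=\bigcap\{ER_P\mid P\in\mathrm{QMax}^{\star_f}(R)\}$. The semistar operation defined by an empty family of overrings of $R$ is, by convention, $E\mapsto L$. For a ring $T$, $T(X):=\{f/g\mid f,g\in T[X],\ \boldsymbol c(g)=T\}$ is its Nagata ring ($\boldsymbol c(g)$ the content ideal of $g$). The semistar operations $[\widetilde\star]$ and $\langle\widetilde\star\rangle$ on $D[X]$ are defined, for $A\in\overline{\boldsymbol F}(D[X])$ and with $Q$ ranging over $\mathrm{QMax}^{\star_f}(D)$,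 by $$A^{[\widetilde\star]}:=\bigcap_Q AD_Q[X],\qquad A^{\langle\widetilde\star\rangle}:=\Big(\bigcap_Q AD_Q(X)\Big)\cap AK[X].$$
   Formalization: When QMax^{⋆_f}(D) is empty, [⋆̃] is taken to be A ↦ AK[X] (the family {D_Q} is replaced by {K}) instead of A ↦ K(X), because the stated convention would make [⋆̃]=⋆_1 false, e.g. for D=K a field and ⋆ the identity. *)

(* Defs.v *)
From mathcomp Require Import all_boot all_algebra.
From mathcomp Require Import boolp classical_sets.

Set Implicit Arguments.
Unset Strict Implicit.
Unset Printing Implicit Defensive.

Import GRing.Theory.
Local Open Scope classical_set_scope.
Local Open Scope ring_scope.

Notation ratfun K := {fraction {poly K}}.
Local Notation "x %:F" := (FracField.tofrac x).

(* An integral domain R is viewed inside its quotient field L through a ring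
   morphism iota : R -> L; R-submodules and overrings of R are subsets of L. *)

Definition nonzero_set (V : nmodType) (E : set V) : Prop :=
  exists2 x, E x & x != 0.

Definition submodule (R : idomainType) (L : fieldType)
    (iota : {rmorphism R -> L}) (E : set L) : Prop :=
  [/\ E 0, forall x y, E x -> E y -> E (x + y)
    & forall a x, E x -> E (iota a * x)].

(* All the finite sums of products a * b; this is the submodule AB as soon as
   A or B is a submodule. *)
Definition prodset (L : pzRingType) (A B : set L) : set L :=
  [set z | exists2 s : seq (L * L),
     (forall p, p \in s -> A p.1 /\ B p.2) & z = \sum_(p <- s) p.1 * p.2].

Definition Fbar (R : idomainType) (L : fieldType)
    (iota : {rmorphism R -> L}) : set (set L) :=
  [set E | submodule iota E /\ nonzero_set E].

Definition Ffg (R : idomainType) (L : fieldType)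
    (iota : {rmorphism R -> L}) : set (set L) :=
  [set E | nonzero_set E /\
     exists s : seq L, E = prodset (range iota) [set x | x \in s]].

(* A semistar operation is represented by a map on all subsets of L, of which
   only the values on Fbar iota are meaningful. *)
Definition semistar (R : idomainType) (L : fieldType)
    (iota : {rmorphism R -> L}) (star : set L -> set L) : Prop :=
  [/\ forall E, Fbar iota E -> Fbar iota (star E),
      forall x E, x != 0 -> Fbar iota E ->
        star [set x * e | e in E] = [set x * e | e in star E],
      forall E F, Fbar iota E -> Fbar iota F -> E `<=` F -> star E `<=` star F,
      forall E, Fbar iota E -> E `<=` star E
    & forall E, Fbar iota E -> star (star E) = star E].

Definition semistar_le (R : idomainType) (L : fieldType)
    (iota : {rmorphism R -> L}) (star1 star2 : set L -> set L) : Prop :=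
  forall E, Fbar iota E -> star1 E `<=` star2 E.

Definition semistar_eq (R : idomainType) (L : fieldType)
    (iota : {rmorphism R -> L}) (star1 star2 : set L -> set L) : Prop :=
  forall E, Fbar iota E -> star1 E = star2 E.

Definition star_f (R : idomainType) (L : fieldType)
    (iota : {rmorphism R -> L}) (star : set L -> set L) : set L -> set L :=
  fun E => \bigcup_(F in [set F | Ffg iota F /\ F `<=` E]) star F.

Definition finite_type (R : idomainType) (L : fieldType)
    (iota : {rmorphism R -> L}) (star : set L -> set L) : Prop :=
  semistar_eq iota star (star_f iota star).

Definition stable (R : idomainType) (L : fieldType)
    (iota : {rmorphism R -> L}) (star : set L -> set L) : Prop :=
  forall E F, Fbar iota E -> Fbar iota F ->
    star (E `&` F) = star E `&` star F.

Definition Spec (R : idomainType) : set (set R) :=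
  [set Q | idealr_closed (mem Q) /\ prime_idealr_closed (mem Q)].

(* idealr_closed only holds of proper ideals. *)
Definition proper_quasi_ideal (R : idomainType) (L : fieldType)
    (iota : {rmorphism R -> L}) (star : set L -> set L) : set (set R) :=
  [set I | [/\ idealr_closed (mem I), nonzero_set I
             & iota @^-1` (star (iota @` I)) = I]].

Definition QMax (R : idomainType) (L : fieldType)
    (iota : {rmorphism R -> L}) (star : set L -> set L) : set (set R) :=
  [set Q | proper_quasi_ideal iota star Q /\
     forall J, proper_quasi_ideal iota star J -> Q `<=` J -> J = Q].

(* The fractions with denominator in S, as a subset of L. *)
Definition localization (R : idomainType) (L : fieldType)
    (iota : {rmorphism R -> L}) (S : set R) : set L :=
  [set z | exists a s, S s /\ z = iota a / iota s].

Definition polyset (R : nzRingType) (T : set R) : set {poly R} :=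
  [set p | forall i, T p`_i].

(* T[X] as a subset of K(X), for T a subset of K. *)
Definition poly_ext (K : fieldType) (T : set K) : set (ratfun K) :=
  [set p%:F | p in polyset T].

Definition content (K : fieldType) (T : set K) (g : {poly K}) : set K :=
  prodset T [set g`_i | i in setT].

(* T(X) as a subset of K(X), for T a subring of K. *)
Definition Nagata (K : fieldType) (T : set K) : set (ratfun K) :=
  [set z | exists f g, [/\ polyset T f, polyset T g, content T g = T
                         & z = f%:F / g%:F]].

Definition to_K (D : idomainType) : {rmorphism D -> {fraction D}} :=
  @FracField.tofrac D.

(* D[X] -> K(X) *)
Definition to_K1 (D : idomainType) :
    {rmorphism {poly D} -> ratfun {fraction D}} :=
  @FracField.tofrac {poly {fraction D}} \o map_poly (to_K D).

(* K_1 -> K_1(Y), the constants *)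
Definition cstY (K1 : fieldType) : {rmorphism K1 -> ratfun K1} :=
  @FracField.tofrac {poly K1} \o polyC.

(* D_1[Y] -> K_1(Y) *)
Definition to_K1Y (D : idomainType) :
    {rmorphism {poly {poly D}}
       -> ratfun (ratfun {fraction D})} :=
  @FracField.tofrac {poly ratfun {fraction D}}
    \o map_poly (to_K1 D).

(* The overrings D_Q, Q in QMax^{star_f}(D). When there is no such Q, the
   family is {K}: E |-> EK = K is then the semistar operation that the empty
   family defines by convention. *)
Definition loc_overrings (D : idomainType)
    (star : set {fraction D} -> set {fraction D}) : set (set {fraction D}) :=
  [set T | exists2 Q, QMax (to_K D) (star_f (to_K D) star) Q
                    & T = localization (to_K D) (~` Q)]
  `|` [set T | QMax (to_K D) (star_f (to_K D) star) = set0 /\ T = setT].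

Definition star_tilde (D : idomainType)
    (star : set {fraction D} -> set {fraction D}) :
    set {fraction D} -> set {fraction D} :=
  fun E => \bigcap_(T in loc_overrings star) prodset E T.

Definition bracket_tilde (D : idomainType)
    (star : set {fraction D} -> set {fraction D}) :
    set (ratfun {fraction D}) -> set (ratfun {fraction D}) :=
  fun A => \bigcap_(T in loc_overrings star) prodset A (poly_ext T).

Definition angle_tilde (D : idomainType)
    (star : set {fraction D} -> set {fraction D}) :
    set (ratfun {fraction D}) -> set (ratfun {fraction D}) :=
  fun A => (\bigcap_(T in loc_overrings star) prodset A (Nagata T))
           `&` prodset A (poly_ext setT).

(* Q_1 |-> Q_1 /\ D *)
Definition contraction (D : idomainType) (Q1 : set {poly D}) : set D :=
  [set d | Q1 d%:P].

Definition Delta1 (D : idomainType)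
    (star : set {fraction D} -> set {fraction D}) : set (set {poly D}) :=
  [set Q1 | Spec Q1 /\
     (contraction Q1 = [set 0] \/
      star_f (to_K D) star (to_K D @` contraction Q1)
        `<` star_f (to_K D) star (range (to_K D)))].

Definition Delta1' (D : idomainType)
    (star : set {fraction D} -> set {fraction D}) : set (set {poly D}) :=
  [set Q1 | Spec Q1 /\
     (contraction Q1 = [set 0] \/
      (Q1 = polyset (contraction Q1) /\
       star_f (to_K D) star (to_K D @` contraction Q1)
         `<` star (range (to_K D))))].

(* D_1[Y] minus the union of the Q_1[Y], Q_1 in Delta *)
Definition mult_set (D : idomainType) (Delta : set (set {poly D})) :
    set {poly {poly D}} :=
  ~` \bigcup_(Q1 in Delta) polyset Q1.

(* A |-> A D_1[Y]_S /\ K_1 *)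
Definition star_of_set (D : idomainType) (S : set {poly {poly D}}) :
    set (ratfun {fraction D}) -> set (ratfun {fraction D}) :=
  fun A => cstY (ratfun {fraction D}) @^-1`
    prodset (cstY (ratfun {fraction D}) @` A)
            (localization (to_K1Y D) S).

Definition star1 (D : idomainType)
    (star : set {fraction D} -> set {fraction D}) :=
  star_of_set (mult_set (Delta1 star)).

Definition star1' (D : idomainType)
    (star : set {fraction D} -> set {fraction D}) :=
  star_of_set (mult_set (Delta1' star)).

(* Main.v *)
Require Import Defs.
From mathcomp Require Import all_boot all_algebra.
From mathcomp Require Import boolp classical_sets.

Set Implicit Arguments.
Unset Strict Implicit.
Unset Printing Implicit Defensive.

Import GRing.Theory.
Local Open Scope classical_set_scope.
Local Open Scope ring_scope.

(* Let C be QMax^{star_f}(D), or {(0)} when that set is empty. For a submodule A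
   and z in K(X), put J = (A :_{D[X]} z). Then z lies in
   - A^[~star]    iff J meets D \ Q for every Q in C;
   - A^<~star>    iff J is contained in no Q[X] with Q in C, and J meets D \ (0);
   - A^{star_1}, resp. A^{star'_1}, iff J contains the coefficients of a
     polynomial g lying in no Q_1[Y], for Q_1 in Delta_1, resp. Delta'_1.
   A prime Q_1 is in Delta_1 iff its contraction to D is inside some Q in C.
   Passing from the last condition to the first two uses primes maximal among
   the ideals containing J and disjoint from D \ Q. In the other direction
   finiteness enters: an ideal I of D contained in no Q in C satisfies
   1 in I^{star_f}, so it contains a finitely generated ideal with the same
   property, whose generators supply the coefficients of g. *)

(** * Maximal sets and finite subsets of chains *)

(** [Zorn_bigcup] also asks for the union of the empty chain, so it is applied to the sets A for
    which I0 ∪ A satisfies P: the empty chain then yields I0 itself. *)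
Lemma zorn_above (T : Type) (P : set (set T)) (I0 : set T) :
  P I0 ->
  (forall F : set (set T), F `<=` P -> F !=set0 -> total_on F subset ->
     P (\bigcup_(J in F) J)) ->
  exists J, [/\ I0 `<=` J, P J & forall J', P J' -> J `<=` J' -> J' = J].
Proof.
move=> PI0 Pchain.
have [F FP Ftot|A [PA Amax]] := @Zorn_bigcup T [set A | P (I0 `|` A)].
  have [[A FA]|F0] := pselect (F !=set0); last first.
    rewrite /= bigcup0 ?setU0// => A FA.
    by case: F0; exists A.
  rewrite /=; have -> : I0 `|` \bigcup_(J in F) J =
    \bigcup_(J in [set I0 `|` A | A in F]) J.
    apply/seteqP; split => [x [I0x|[B FB Bx]]|x [_ [B FB <-] [I0x|Bx]]].
    - by exists (I0 `|` A); [exists A | left].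
    - by exists (I0 `|` B); [exists B | right].
    - by left.
    - by right; exists B.
  apply: Pchain; first by move=> _ [B FB <-]; exact: FP.
    by exists (I0 `|` A); exists A.
  move=> _ _ [B FB <-] [C FC <-].
  by have [BC|CB] := Ftot _ _ FB FC; [left|right]; apply: setUS.
exists (I0 `|` A); split => // J' PJ' sJ'.
apply: contrapT => neqJ'; apply: (Amax J').
  split; first by apply: subset_trans sJ'; exact: subsetUr.
  by move=> sA; apply: neqJ'; apply/seteqP; split => // x /sA; right.
by rewrite /= setUC setUidl// => x Ix; apply: sJ'; left.
Qed.

Lemma chain_seq (T : eqType) (F : set (set T)) (s : seq T) :
  F !=set0 -> total_on F subset ->
  (forall x, x \in s -> (\bigcup_(J in F) J) x) ->
  exists2 J, F J & forall x, x \in s -> J x.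
Proof.
move=> [J0 FJ0] Ftot; elim: s => [|a s IH] sF; first by exists J0.
have [|J FJ sJ] := IH; first by move=> x xs; apply: sF; rewrite inE xs orbT.
have [|J' FJ' aJ'] := sF a; first by rewrite inE eqxx.
have [JJ'|J'J] := Ftot _ _ FJ FJ'; [exists J' => //|exists J => //] => x;
  by rewrite inE => /predU1P[->|/sJ]//; auto.
Qed.

Lemma seq_image (T U : eqType) (f : T -> U) (A : set T) (s : seq U) :
  (forall y, y \in s -> (f @` A) y) ->
  exists2 t, s = map f t & forall x, x \in t -> A x.
Proof.
elim: s => [|a s IH] sA; first by exists [::].
have [|t -> tA] := IH; first by move=> x xs; apply: sA; rewrite inE xs orbT.
have [|b Ab <-] := sA a; first by rewrite inE eqxx.
by exists (b :: t) => // x; rewrite inE => /predU1P[->|/tA].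
Qed.

(** * Ideals, and primes avoiding a multiplicative set *)

(** Unlike [idealr_closed], this admits the unit ideal; a colon ideal can be the whole ring. *)
Definition is_ideal (R : nzRingType) (I : set R) : Prop :=
  [/\ I 0, forall x y, I x -> I y -> I (x + y) & forall a x, I x -> I (a * x)].

Lemma idealr_closedP (R : nzRingType) (I : set R) :
  idealr_closed (mem I) <-> is_ideal I /\ ~ I 1.
Proof.
split=> [[I0 I1 IM]|[[I0 ID IM] I1]].
  have {}IM a x y : I x -> I y -> I (a * x + y).
    by move=> Ix Iy; apply/set_mem; apply: IM; apply/mem_set.
  split; last by move=> /mem_set; apply/negP.
  have {}I0 : I 0 := set_mem I0.
  split => // [x y Ix Iy|a x Ix]; first by rewrite -[x]mul1r; apply: IM.
  by rewrite -[a * x]addr0; apply: IM.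
split; first exact/mem_set; first by apply/negP => /set_mem.
move=> a x y /set_mem Ix /set_mem Iy; apply/mem_set.
by apply: ID => //; apply: IM.
Qed.

Lemma SpecP (R : idomainType) (Q : set R) :
  Spec Q <-> [/\ is_ideal Q, ~ Q 1 & forall x y, Q (x * y) -> Q x \/ Q y].
Proof.
split=> [[/idealr_closedP[QI Q1] QM]|[QI Q1 QM]]; split => //.
- by move=> x y /mem_set/QM/orP[]/set_mem; auto.
- exact/idealr_closedP.
- move=> x y /set_mem/QM[]/mem_set Qx; apply/orP; [left|right]; exact: Qx.
Qed.

Lemma is_ideal_sum (R : nzRingType) (I : set R) (T : Type) (r : seq T)
    (P : pred T) (F : T -> R) :
  is_ideal I -> (forall i, P i -> I (F i)) -> I (\sum_(i <- r | P i) F i).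
Proof. by move=> [I0 ID _] IF; apply: (big_ind I). Qed.

Lemma is_idealBr (R : nzRingType) (I : set R) (x y : R) :
  is_ideal I -> I (x + y) -> I x -> I y.
Proof.
move=> [_ ID IM] Ixy Ix.
by rewrite -(addKr x y) addrC; apply: ID => //; rewrite -mulN1r; apply: IM.
Qed.

Lemma is_ideal_bigcup (R : nzRingType) (F : set (set R)) :
  F !=set0 -> total_on F subset -> (forall J, F J -> is_ideal J) ->
  is_ideal (\bigcup_(J in F) J).
Proof.
move=> [J0 FJ0] Ftot FI; split.
- by exists J0 => //; have [] := FI _ FJ0.
- move=> x y [J FJ Jx] [J' FJ' Jy].
  have [JJ'|J'J] := Ftot _ _ FJ FJ'; [exists J' => //|exists J => //].
    by have [_ ID _] := FI _ FJ'; apply: ID; auto.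
  by have [_ ID _] := FI _ FJ; apply: ID; auto.
- by move=> a x [J FJ Jx]; exists J => //; have [_ _ IM] := FI _ FJ; apply: IM.
Qed.

Definition mult_closed (R : nzRingType) (S : set R) : Prop :=
  S 1 /\ forall x y, S x -> S y -> S (x * y).

(** This is I + Rx, used to test the maximality of I against an element x outside it. *)
Lemma is_ideal_addl (R : comNzRingType) (I : set R) (x : R) :
  is_ideal I -> is_ideal [set z | exists2 q, I q & exists a, z = q + a * x].
Proof.
move=> [I0 ID IM]; split.
- by exists 0 => //; exists 0; rewrite mul0r addr0.
- move=> _ _ [q Iq [a ->]] [r Ir [b ->]]; exists (q + r); first exact: ID.
  by exists (a + b); rewrite mulrDl addrACA.
- move=> c _ [q Iq [a ->]]; exists (c * q); first exact: IM.
  by exists (c * a); rewrite mulrDr mulrA.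
Qed.

(** An ideal Q maximal among those containing I and disjoint from M is prime: if x and y are outside
    Q, then Q + Rx and Q + Ry meet M, and the product of the two elements found lies in M and in Q +
    Rxy, so xy is outside Q. *)
Lemma prime_avoiding (R : idomainType) (I M : set R) :
  is_ideal I -> mult_closed M -> I `&` M = set0 ->
  exists Q, [/\ Spec Q, I `<=` Q & Q `&` M = set0].
Proof.
move=> II [M1 MM] IM0.
pose P := [set J : set R | is_ideal J /\ J `&` M = set0].
have [||Q [IQ [QI QM] Qmax]] := @zorn_above _ P I; first by split.
  move=> F FP F0 Ftot; split.
    by apply: is_ideal_bigcup => // J /FP[].
  by rewrite setI_bigcupl bigcup0// => J /FP[].
exists Q; split => //; apply/SpecP; split => //.
  by move=> Q1; have : (Q `&` M) 1 by []; rewrite QM.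
have meets z : ~ Q z -> exists q a, Q q /\ M (q + a * z).
  move=> Qz; apply: contrapT => Nz; apply: Qz.
  have [Q0 _ _] := QI.
  rewrite -(Qmax [set w | exists2 q, Q q & exists a, w = q + a * z]).
  - by exists 0 => //; exists 1; rewrite mul1r add0r.
  - split; first exact: is_ideal_addl.
    rewrite -subset0 => w [[q Qq [a ->]] Mw]; apply: Nz.
    by exists q, a.
  - by move=> q Qq; exists q => //; exists 0; rewrite mul0r addr0.
move=> x y Qxy; apply: contrapT => /not_orP[/meets[q [a [Qq Mx]]]].
move=> /meets[r [b [Qr My]]].
have [_ QD QMl] := QI.
suff : (Q `&` M) ((q + a * x) * (r + b * y)) by rewrite QM.
split; last exact: MM.
have -> : (q + a * x) * (r + b * y) =
    (r + b * y) * q + ((a * x) * r + (a * b) * (x * y)).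
  by rewrite mulrDl [q * _]mulrC mulrDr [a * x * (b * y)]mulrACA.
by apply: (QD); [|apply: (QD)]; apply: QMl.
Qed.

Lemma polyset_ideal (R : nzRingType) (I : set R) :
  is_ideal I -> is_ideal (polyset I).
Proof.
move=> II; have [I0 ID IM] := II; split.
- by move=> i; rewrite coef0.
- by move=> p q Ip Iq i; rewrite coefD; apply: ID; [apply: Ip|apply: Iq].
- move=> a p Ip i; rewrite coefM; apply: is_ideal_sum => // j _.
  exact/IM/Ip.
Qed.

(* Gauss: if p_i and q_j are the first coefficients outside Q, then every
   other term of (pq)_{i+j} lies in Q. *)
Lemma polyset_prime (R : idomainType) (Q : set R) :
  Spec Q -> Spec (polyset Q).
Proof.
move=> /SpecP[QI Q1 QP]; apply/SpecP; split; first exact: polyset_ideal.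
  by move=> /(_ 0%N); rewrite coef1.
move=> p q Qpq; apply: contrapT => /not_orP[Np Nq].
have first_out (r : {poly R}) : ~ polyset Q r ->
    exists i, ~ Q r`_i /\ forall j, (j < i)%N -> Q r`_j.
  move=> Nr; have /existsNP[i0 Ni0] : ~ forall i, Q r`_i by [].
  have ex : exists i, `[< ~ Q r`_i >] by exists i0; apply/asboolP.
  case: (ex_minnP ex) => i /asboolP Ni imin; exists i; split => // j ji.
  apply: contrapT => Nj; move: ji; rewrite ltnNge => /negP; apply.
  exact/imin/asboolP.
have [i [Ni ilt]] := first_out _ Np; have [j [Nj jlt]] := first_out _ Nq.
have [_ _ QM] := QI.
have := Qpq (i + j)%N; rewrite coefM.
have lti : (i < (i + j).+1)%N by rewrite ltnS leq_addr.
rewrite (bigD1 (Ordinal lti))//= addKn addrC => Qsum.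
suff Qij : Q (p`_i * q`_j) by case: (QP _ _ Qij).
apply: (is_idealBr QI Qsum); apply: is_ideal_sum => // k kNi.
have [ki|ik|kiE] := ltngtP k i; last by rewrite -val_eqE/= kiE eqxx in kNi.
  by rewrite mulrC; apply/QM/ilt.
by apply/QM/jlt; rewrite ltn_subLR ?ltn_add2r// -ltnS.
Qed.

(** * Products of submodules and finitely generated submodules *)

(** Acts as the induction principle for [prodset]. *)
Lemma prodset_min (L : pzRingType) (A B P : set L) :
  P 0 -> (forall x y, P x -> P y -> P (x + y)) ->
  (forall a b, A a -> B b -> P (a * b)) -> prodset A B `<=` P.
Proof.
move=> P0 PD PM _ [s sAB ->].
elim: s sAB => [|p s IH] sAB; first by rewrite big_nil.
rewrite big_cons; apply: PD.
  by have [Ap Bp] := sAB p (mem_head _ _); apply: PM.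
by apply: IH => q qs; apply: sAB; rewrite inE qs orbT.
Qed.

Lemma prodset0 (L : pzRingType) (A B : set L) : prodset A B 0.
Proof. by exists [::] => //; rewrite big_nil. Qed.

Lemma prodsetD (L : pzRingType) (A B : set L) (x y : L) :
  prodset A B x -> prodset A B y -> prodset A B (x + y).
Proof.
move=> [s sAB ->] [t tAB ->]; exists (s ++ t); last by rewrite big_cat.
by move=> p; rewrite mem_cat => /orP[/sAB|/tAB].
Qed.

Lemma prodsetM (L : pzRingType) (A B : set L) (a b : L) :
  A a -> B b -> prodset A B (a * b).
Proof.
move=> Aa Bb; exists [:: (a, b)]; last by rewrite big_seq1.
by move=> p; rewrite inE => /eqP->.
Qed.

Definition fgspan (R : idomainType) (L : fieldType) (iota : {rmorphism R -> L})
  (s : seq L) : set L := prodset (range iota) [set x | x \in s].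

Lemma fgspan_submodule (R : idomainType) (L : fieldType)
    (iota : {rmorphism R -> L}) (s : seq L) : submodule iota (fgspan iota s).
Proof.
split=> [|x y|a]; [exact: prodset0|exact: prodsetD|].
apply: prodset_min; first by rewrite mulr0; exact: prodset0.
  by move=> x y Px Py; rewrite mulrDr; apply: prodsetD.
by move=> _ x [b _ <-] xs; rewrite mulrA -rmorphM; apply: prodsetM => //; exists (a * b).
Qed.

Lemma mem_fgspan (R : idomainType) (L : fieldType) (iota : {rmorphism R -> L})
  (s : seq L) (x : L) : x \in s -> fgspan iota s x.
Proof.
by move=> xs; rewrite -[x]mul1r -(rmorph1 iota); apply: prodsetM => //; exists 1.
Qed.

Lemma fgspan_min (R : idomainType) (L : fieldType) (iota : {rmorphism R -> L})
    (s : seq L) (E : set L) :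
  submodule iota E -> (forall x, x \in s -> E x) -> fgspan iota s `<=` E.
Proof.
move=> [E0 ED EM] sE; apply: prodset_min => // _ x [a _ <-] /sE; exact: EM.
Qed.

Lemma scale_submodule (R : idomainType) (L : fieldType)
    (iota : {rmorphism R -> L}) (x : L) (E : set L) :
  submodule iota E -> submodule iota [set x * e | e in E].
Proof.
move=> [E0 ED EM]; split; first by exists 0 => //; rewrite mulr0.
  by move=> _ _ [e Ee <-] [f Ef <-]; exists (e + f); rewrite ?mulrDr//; apply: ED.
by move=> a _ [e Ee <-]; exists (iota a * e); [apply: EM|rewrite mulrCA].
Qed.

Lemma scale_fgspan (R : idomainType) (L : fieldType) (iota : {rmorphism R -> L})
    (x : L) (s : seq L) :
  [set x * e | e in fgspan iota s] = fgspan iota [seq x * e | e <- s].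
Proof.
apply/seteqP; split; last first.
  apply: fgspan_min; first exact/scale_submodule/fgspan_submodule.
  by move=> _ /mapP[e es ->]; exists e => //; apply: mem_fgspan.
move=> _ [e + <-]; move: e; apply: prodset_min.
- by rewrite mulr0; exact: prodset0.
- by move=> y z sy sz; rewrite mulrDr; apply: prodsetD.
- move=> _ y [a _ <-] ys; rewrite mulrCA; apply: prodsetM; first by exists a.
  exact: map_f.
Qed.

Lemma Ffg_Fbar (R : idomainType) (L : fieldType) (iota : {rmorphism R -> L})
  (F : set L) : Ffg iota F -> Fbar iota F.
Proof. by move=> [F0 [s FE]]; split => //; rewrite FE; apply: fgspan_submodule. Qed.

Lemma Ffg_fgspan (R : idomainType) (L : fieldType) (iota : {rmorphism R -> L})
  (s : seq L) (x : L) : x \in s -> x != 0 -> Ffg iota (fgspan iota s).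
Proof.
by move=> xs x0; split; [exists x => //; apply: mem_fgspan|exists s].
Qed.

Lemma range_submodule (R : idomainType) (L : fieldType)
    (iota : {rmorphism R -> L}) (I : set R) :
  is_ideal I -> submodule iota (iota @` I).
Proof.
move=> [I0 ID IM]; split; first by exists 0; rewrite ?rmorph0.
  by move=> _ _ [x Ix <-] [y Iy <-]; exists (x + y); rewrite ?rmorphD//; apply: ID.
by move=> a _ [x Ix <-]; exists (a * x); rewrite ?rmorphM//; apply: IM.
Qed.

(** * The operation star_f and its maximal quasi-ideals *)

Lemma star_f_mono (R : idomainType) (L : fieldType)
    (iota : {rmorphism R -> L}) (star : set L -> set L) (E F : set L) :
  E `<=` F -> star_f iota star E `<=` star_f iota star F.
Proof.
by move=> EF x [G [GF GE] Gx]; exists G => //; split=> //; exact: subset_trans EF.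
Qed.

(** Concatenating generators shows that the finitely generated submodules of E form a directed
    family. *)
Lemma Ffg_add (R : idomainType) (L : fieldType) (iota : {rmorphism R -> L})
    (E F G : set L) :
  submodule iota E -> Ffg iota F -> F `<=` E -> Ffg iota G -> G `<=` E ->
  exists H, [/\ Ffg iota H, H `<=` E, F `<=` H & G `<=` H].
Proof.
move=> ES [[x Fx x0] [s FE]] FsubE [_ [t GE]] GsubE.
have sub (u : seq L) : {subset u <= s ++ t} ->
    fgspan iota u `<=` fgspan iota (s ++ t).
  move=> uP; apply: fgspan_min; first exact: fgspan_submodule.
  by move=> y /uP; apply: mem_fgspan.
have Fst : F `<=` fgspan iota (s ++ t).
  by rewrite FE; apply: sub => y ys; rewrite mem_cat ys.
exists (fgspan iota (s ++ t)); split => //.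
- by split; [exists x => //; apply: Fst|exists (s ++ t)].
- apply: fgspan_min => // y; rewrite mem_cat => /orP[ys|yt].
    by apply: FsubE; rewrite FE; apply: mem_fgspan.
  by apply: GsubE; rewrite GE; apply: mem_fgspan.
- by rewrite GE; apply: sub => y yt; rewrite mem_cat yt orbT.
Qed.

(** By directedness a single F witnesses finitely many elements of the union defining star_f;
    closure under sums and idempotence both rest on this. *)
Lemma star_f_common (R : idomainType) (L : fieldType)
    (iota : {rmorphism R -> L}) (star : set L -> set L) (E : set L)
    (s : seq L) :
  semistar iota star -> Fbar iota E ->
  (forall x, x \in s -> star_f iota star E x) ->
  exists F, [/\ Ffg iota F, F `<=` E & forall x, x \in s -> star F x].
Proof.
move=> [_ _ smono _ _] [ES [e Ee e0]]; elim: s => [|a s IH] sE.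
  (* [Ffg] asks for a nonzero submodule, hence the nonzero element e of E as generator. *)
  exists (fgspan iota [:: e]); split => //.
    by apply: (@Ffg_fgspan _ _ _ _ e); rewrite ?mem_head.
  by apply: fgspan_min => // x; rewrite inE => /eqP->.
have [|F [FF FE sF]] := IH; first by move=> x xs; apply: sE; rewrite inE xs orbT.
have [G [GF GE] aG] := sE a (mem_head _ _).
have [H [HF HE FH GH]] := Ffg_add ES FF FE GF GE.
exists H; split => // x; rewrite inE => /predU1P[->|/sF].
  by apply: smono aG => //; exact: Ffg_Fbar.
by apply: smono => //; exact: Ffg_Fbar.
Qed.

Lemma star_f_submodule (R : idomainType) (L : fieldType)
    (iota : {rmorphism R -> L}) (star : set L -> set L) (E : set L) :
  semistar iota star -> Fbar iota E -> submodule iota (star_f iota star E).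
Proof.
move=> sstar EF; have [sF _ _ _ _] := sstar.
have [_ [e Ee e0]] := EF.
split.
- have [|F [FF FE _]] := @star_f_common _ _ _ _ _ [::] sstar EF; first by [].
  by exists F => //; have [[]] := sF _ (Ffg_Fbar FF).
- move=> x y Ex Ey.
  have [|F [FF FE xyF]] := @star_f_common _ _ _ _ _ [:: x; y] sstar EF.
    by move=> z; rewrite !inE => /orP[]/eqP->.
  exists F => //; have [[_ FD _] _] := sF _ (Ffg_Fbar FF).
  by apply: FD; apply: xyF; rewrite !inE eqxx ?orbT.
- move=> a x [F [FF FE] Fx]; exists F => //.
  by have [[_ _ FM] _] := sF _ (Ffg_Fbar FF); apply: FM.
Qed.

Lemma sub_star_f (R : idomainType) (L : fieldType)
    (iota : {rmorphism R -> L}) (star : set L -> set L) (E : set L) :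
  semistar iota star -> Fbar iota E -> E `<=` star_f iota star E.
Proof.
move=> sstar EF x Ex; have [ES [e Ee e0]] := EF; have [_ _ _ sext _] := sstar.
(* As x may be 0, the nonzero element e is added to the generators. *)
have FF : Ffg iota (fgspan iota [:: x; e]).
  by apply: (@Ffg_fgspan _ _ _ _ e); rewrite ?inE ?eqxx ?orbT.
exists (fgspan iota [:: x; e]); first split => //.
  by apply: fgspan_min => // y; rewrite !inE => /orP[]/eqP->.
by apply: sext; [exact: Ffg_Fbar|apply: mem_fgspan; rewrite mem_head].
Qed.

(** The generators of a finitely generated G inside F all lie in H^star for one finitely generated H
    inside E, so G^star is contained in (H^star)^star = H^star. *)
Lemma star_f_idem (R : idomainType) (L : fieldType)
    (iota : {rmorphism R -> L}) (star : set L -> set L) (E F : set L) :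
  semistar iota star -> Fbar iota E -> F `<=` star_f iota star E ->
  star_f iota star F `<=` star_f iota star E.
Proof.
move=> sstar EF FE x [G [GF GsubF] Gx].
have [sF _ smono _ sidem] := sstar.
have [_ [s GE]] := GF.
have [|H [HF HE sH]] := @star_f_common _ _ _ _ _ s sstar EF.
  by move=> y ys; apply/FE/GsubF; rewrite GE; apply: mem_fgspan.
exists H => //; rewrite -sidem; last exact: Ffg_Fbar.
have HFb := Ffg_Fbar HF.
apply: smono Gx; [exact: Ffg_Fbar|exact: sF|].
by rewrite GE; apply: fgspan_min sH; have [] := sF _ HFb.
Qed.

Lemma image_Fbar (R : idomainType) (L : fieldType)
    (iota : {rmorphism R -> L}) (I : set R) :
  injective iota -> is_ideal I -> nonzero_set I -> Fbar iota (iota @` I).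
Proof.
move=> iinj II [x Ix x0]; split; first exact: range_submodule.
by exists (iota x); [exists x|rewrite -(rmorph0 iota) (inj_eq iinj)].
Qed.

(** Q is maximal among the ideals J containing I with 1 outside J^{star_f}. Unions of chains keep
    this property because a finitely generated witness already lies in one member. By idempotence
    the quasi-closure of Q has it too, hence equals Q. *)
Lemma QMax_above (R : idomainType) (L : fieldType)
    (iota : {rmorphism R -> L}) (star : set L -> set L) (I : set R) :
  injective iota -> semistar iota star -> is_ideal I -> nonzero_set I ->
  ~ star_f iota star (iota @` I) 1 ->
  exists2 Q, QMax iota (star_f iota star) Q & I `<=` Q.
Proof.
move=> iinj sstar II I0 I1.
have ext J : I `<=` J -> nonzero_set J by move=> IJ; case: I0 => x /IJ; exists x.
pose P := [set J : set R |
  [/\ is_ideal J, I `<=` J & ~ star_f iota star (iota @` J) 1]].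
have [||Q [IQ [QI _ Q1] Qmax]] := @zorn_above _ P I; first by split.
  move=> F FP F0 Ftot; split.
  - by apply: is_ideal_bigcup => // J /FP[].
  - by case: F0 => J FJ x Ix; exists J => //; have [_ IJ _] := FP _ FJ; apply: IJ.
  - move=> [G [GF GU] G1]; have [G0 [s GE]] := GF.
    have [|t sE tU] := @seq_image _ _ iota (\bigcup_(J in F) J) s.
      by move=> y ys; apply: GU; rewrite GE; apply: mem_fgspan.
    have [J FJ tJ] := chain_seq F0 Ftot tU.
    have [JI _ J1] := FP _ FJ; apply: J1; exists G => //; split => //.
    rewrite GE; apply: fgspan_min; first exact: range_submodule.
    by move=> y; rewrite sE => /mapP[z /tJ Jz ->]; exists z.
exists Q => //.
have QF : Fbar iota (iota @` Q) by apply: image_Fbar => //; exact: ext.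
have one_in J : J 1 -> is_ideal J -> I `<=` J -> star_f iota star (iota @` J) 1.
  move=> J1 JI IJ; apply: sub_star_f => //; first by apply: image_Fbar => //; exact: ext.
  by exists 1; rewrite ?rmorph1.
split; first split.
- by apply/idealr_closedP; split => // Q1'; apply: Q1; apply: one_in.
- exact: ext.
- have [S0 SD SM] := star_f_submodule sstar QF.
  have QsQ : Q `<=` iota @^-1` star_f iota star (iota @` Q).
    by move=> x Qx; apply: sub_star_f => //; exists x.
  apply: Qmax => //; split.
  + split; first by rewrite /= rmorph0.
      by move=> x y; rewrite /= rmorphD; exact: SD.
    by move=> a x; rewrite /= rmorphM; exact: SM.
  + exact: subset_trans QsQ.
  + by move=> /(star_f_idem sstar QF) h; apply/Q1/h => _ [x Qx <-].
- move=> J [/idealr_closedP[JI J1] J0 JE] QJ.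
  apply: Qmax => //; split => //; first exact: subset_trans QJ.
  by move=> sJ; apply: J1; rewrite -JE /= rmorph1.
Qed.

Lemma QMax_star_f1 (R : idomainType) (L : fieldType)
    (iota : {rmorphism R -> L}) (star : set L -> set L) (Q : set R) :
  QMax iota star Q -> ~ star (iota @` Q) 1.
Proof.
move=> [[/idealr_closedP[_ Q1] _ QE] _] s1; apply: Q1.
by rewrite -QE /= rmorph1.
Qed.

(* If x is outside Q, then 1 lies in F^star for a finitely generated F inside
   Q + xR; as xy is in Q, yF lies in Q, hence so does y. *)
Lemma QMax_prime (R : idomainType) (L : fieldType)
    (iota : {rmorphism R -> L}) (star : set L -> set L) (Q : set R) :
  injective iota -> semistar iota star -> QMax iota (star_f iota star) Q ->
  Spec Q.
Proof.
move=> iinj sstar [[/idealr_closedP[QI Q1] Q0 QE] Qmax].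
have [Qz QD QM] := QI.
apply/SpecP; split => // x y Qxy.
have [Qx|Nx] := pselect (Q x); [by left|right].
have [->//|y0] := eqVneq y 0.
pose I := [set z | exists2 q, Q q & exists a, z = q + a * x].
have QsI : Q `<=` I by move=> q Qq; exists q => //; exists 0; rewrite mul0r addr0.
have II : is_ideal I by exact: is_ideal_addl.
have I0 : nonzero_set I by case: Q0 => z /QsI; exists z.
have [[F [FF FI] F1]|/(QMax_above iinj sstar II I0)[Q' [Q'p Q'max] IQ']] :=
    pselect (star_f iota star (iota @` I) 1); last first.
  (* A maximal quasi-ideal above Q + xR equals Q, although x is outside Q. *)
  case: Nx; rewrite -(Qmax _ Q'p); last exact: subset_trans IQ'.
  by apply: IQ'; exists 0 => //; exists 1; rewrite mul1r add0r.
rewrite -QE /=.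
have [[f Ff f0] [s FE]] := FF.
have iy0 : iota y != 0 by rewrite -(rmorph0 iota) (inj_eq iinj).
have [_ sscale _ _ _] := sstar.
exists [set iota y * e | e in F]; last first.
  by rewrite sscale//; [exists 1; rewrite ?mulr1|exact: Ffg_Fbar].
split.
  split; first by exists (iota y * f); [exists f|rewrite mulf_neq0].
  by exists [seq iota y * e | e <- s]; rewrite FE; apply: scale_fgspan.
move=> _ [e /FI [_ [q Qq [a ->]] <-] <-].
exists (y * (q + a * x)); last by rewrite rmorphM.
rewrite mulrDr mulrCA [y * x]mulrC.
by apply: QD; apply: QM.
Qed.

(** * Fractions, localizations and common denominators *)

Lemma fractionP (D : idomainType) (x : {fraction D}) :
  exists a b, b != 0 /\ x = to_K D a / to_K D b.
Proof.
elim/quotW: x => x; exists (frac x).1, (frac x).2.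
split; first exact: denom_ratioP.
have dx0 : to_K D (frac x).2 != 0.
  by rewrite tofrac_eq0 denom_ratioP.
(* Once the denominator is cleared, the equality unfolds to cross products of representatives. *)
apply/eqP; rewrite eq_sym -(inj_eq (mulIf dx0)) divfK// eq_sym.
rewrite [X in X == _]/GRing.mul /= !piE.
rewrite FracField.equivfE /FracField.mulf !numden_Ratio
  ?mulf_neq0 ?denom_ratioP ?oner_neq0//.
by rewrite !mulr1 mulrC.
Qed.

Lemma to_K_inj (D : idomainType) : injective (to_K D).
Proof. by move=> x y /eqP; rewrite tofrac_eq => /eqP. Qed.

Lemma to_K1_inj (D : idomainType) : injective (to_K1 D).
Proof.
move=> p q /eqP; rewrite tofrac_eq => /eqP.
by apply: map_inj_poly; [exact: to_K_inj|exact: rmorph0].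
Qed.

Lemma rmorph_inj_eq0 (R S : nzRingType) (f : {rmorphism R -> S}) (x : R) :
  injective f -> (f x == 0) = (x == 0).
Proof. by move=> finj; rewrite -(rmorph0 f) (inj_eq finj). Qed.

Lemma localization_setC0 (D : idomainType) :
  localization (to_K D) (~` [set 0]) = setT.
Proof.
apply/seteqP; split => // x _; have [a [b [/eqP b0 ->]]] := fractionP x.
by exists a, b.
Qed.

Lemma localization_add (R : idomainType) (L : fieldType)
    (iota : {rmorphism R -> L}) (S : set R) (x y : L) :
  mult_closed S -> (forall s, S s -> iota s != 0) ->
  localization iota S x -> localization iota S y ->
  localization iota S (x + y).
Proof.
move=> [_ SM] Snz [a [s [Ss ->]]] [b [t [St ->]]].
exists (a * t + b * s), (s * t); split; first exact: SM.
by rewrite addf_div ?Snz// rmorphD !rmorphM.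
Qed.

Lemma localization_mul (R : idomainType) (L : fieldType)
    (iota : {rmorphism R -> L}) (S : set R) (x y : L) :
  mult_closed S -> localization iota S x -> localization iota S y ->
  localization iota S (x * y).
Proof.
move=> [_ SM] [a [s [Ss ->]]] [b [t [St ->]]].
by exists (a * b), (s * t); split; [exact: SM|rewrite !rmorphM mulf_div].
Qed.

Lemma localization_iota (R : idomainType) (L : fieldType)
    (iota : {rmorphism R -> L}) (S : set R) (a : R) :
  mult_closed S -> localization iota S (iota a).
Proof. by move=> [S1 _]; exists a, 1; rewrite rmorph1 divr1. Qed.

(** The product of the finitely many denominators is a common one. The set A is arbitrary and is
    replaced by its span, since the lemma is also applied to constants of K_1(Y), which do not form
    a D_1[Y]-module. *)
Lemma prodset_localization (R : idomainType) (L : fieldType)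
    (iota : {rmorphism R -> L}) (A : set L) (S : set R) (z : L) :
  mult_closed S -> (forall s, S s -> iota s != 0) ->
  prodset A (localization iota S) z <->
  exists2 s, S s & prodset A (range iota) (iota s * z).
Proof.
move=> [S1 SM] Snz; split.
  have rangeM (u w : L) : range iota u -> prodset A (range iota) w ->
      prodset A (range iota) (u * w).
    move=> [r _ <-]; move: w; apply: prodset_min.
    - by rewrite mulr0; exact: prodset0.
    - by move=> x y Px Py; rewrite mulrDr; apply: prodsetD.
    - move=> a _ Aa [b _ <-]; rewrite mulrCA -rmorphM.
      by apply: prodsetM => //; exists (r * b).
  move: z; apply: prodset_min.
  - by exists 1 => //; rewrite mulr0; exact: prodset0.
  - move=> x y [s Ss Ax] [t St Ay]; exists (s * t); first exact: SM.
    rewrite rmorphM mulrDr; apply: prodsetD.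
      by rewrite [iota s * _]mulrC -mulrA; apply: rangeM Ax; exists t.
    by rewrite -mulrA; apply: rangeM Ay; exists s.
  - move=> a _ Aa [b [s [Ss ->]]]; exists s => //.
    rewrite mulrCA [iota s * _]mulrC divfK ?Snz//.
    by apply: prodsetM => //; exists b.
move=> [s Ss] Asz; rewrite -[z](mulKf (Snz s Ss)).
move: (iota s * z) Asz; apply: prodset_min.
- by rewrite mulr0; exact: prodset0.
- by move=> x y Px Py; rewrite mulrDr; apply: prodsetD.
- move=> a _ Aa [b _ <-]; rewrite mulrCA; apply: prodsetM => //.
  by exists b, s; rewrite mulrC.
Qed.

Lemma prodset_range (R : idomainType) (L : fieldType)
    (iota : {rmorphism R -> L}) (A : set L) :
  submodule iota A -> prodset A (range iota) = A.
Proof.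
move=> [A0 AD AM]; apply/seteqP; split.
  by apply: prodset_min => // a _ Aa [b _ <-]; rewrite mulrC; exact: AM.
by move=> a Aa; rewrite -[a]mulr1 -(rmorph1 iota); apply: prodsetM => //; exists 1.
Qed.

Lemma polyset_localization (R : idomainType) (L : fieldType)
    (iota : {rmorphism R -> L}) (S : set R) (p : {poly L}) :
  mult_closed S -> (forall s, S s -> iota s != 0) ->
  polyset (localization iota S) p ->
  exists s f, S s /\ map_poly iota f = iota s *: p.
Proof.
move=> [S1 SM] Snz; elim/poly_ind: p => [|p c IH] pS.
  by exists 1, 0; rewrite scaler0 rmorph0.
have [|s [f [Ss fE]]] := IH.
  by move=> i; have := pS i.+1; rewrite coefD coefMX coefC addr0.
have [a [t [St cE]]] : localization iota S c.
  by have := pS 0%N; rewrite coefD coefMX coefC add0r.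
(* For p'X + c with sp' = f and tc = a, multiplication by st gives tfX + sa. *)
exists (s * t), (t *: f * 'X + (s * a)%:P); split; first exact: SM.
have {}cE : iota t * c = iota a by rewrite cE mulrC divfK ?Snz.
rewrite rmorphD (rmorphM _ (t *: f)) /= map_polyX map_polyZ map_polyC /= fE.
rewrite scalerA [iota t * _]mulrC !rmorphM scalerDr scalerAl; congr (_ + _).
by rewrite -mul_polyC -polyCM -mulrA cE -polyCM.
Qed.

Lemma compl_prime_mult_closed (R : idomainType) (Q : set R) :
  Spec Q -> mult_closed (~` Q).
Proof. by move=> /SpecP[_ Q1 QP]; split => // x y Nx Ny /QP[]. Qed.

Lemma compl_ideal_neq0 (R : idomainType) (L : fieldType)
    (iota : {rmorphism R -> L}) (Q : set R) :
  injective iota -> Q 0 -> forall s, (~` Q) s -> iota s != 0.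
Proof.
by move=> iinj Q0 s Ns; rewrite rmorph_inj_eq0//; apply/eqP => s0; apply: Ns; rewrite s0.
Qed.

(** * D_Q[X] and D_Q(X) as localizations of D[X] *)

Lemma to_K1C (D : idomainType) (d : D) :
  to_K1 D d%:P = FracField.tofrac (to_K D d)%:P.
Proof. by rewrite /= map_polyC. Qed.

(** A common denominator of the coefficients can be taken among the constants outside Q. In this
    form [prodset_localization] applies to AD_Q[X]. *)
Lemma poly_ext_localization (D : idomainType) (Q : set D) :
  Spec Q ->
  poly_ext (localization (to_K D) (~` Q)) =
  localization (to_K1 D) [set d%:P | d in ~` Q].
Proof.
move=> QP; have SM := compl_prime_mult_closed QP.
have [[Q0 _ _] _ _] := (SpecP Q).1 QP.
have Snz := compl_ideal_neq0 (@to_K_inj D) Q0.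
apply/seteqP; split.
  move=> _ [p /(polyset_localization SM Snz)[s [f [Ss fE]]] <-].
  exists f, s%:P; split; first by exists s.
  rewrite to_K1C /= fE -mul_polyC tofracM mulrC mulKf//.
  by rewrite tofrac_eq0 polyC_eq0 Snz.
move=> _ [f [_ [[s Ss <-] ->]]].
exists ((to_K D s)^-1 *: map_poly (to_K D) f).
  by move=> i; rewrite coefZ coef_map; exists f`_i, s; rewrite mulrC.
rewrite to_K1C /=; apply: (canRL (mulfK _)).
  by rewrite tofrac_eq0 polyC_eq0 Snz.
by rewrite -tofracM mulrC mul_polyC scalerA mulfV ?Snz// scale1r.
Qed.

(** D_Q is local with maximal ideal QD_Q, so a content is the unit ideal exactly when some
    coefficient is a unit; f and g differ by the unit s. *)
Lemma content_localization (D : idomainType) (Q : set D) (g : {poly {fraction D}})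
    (s : D) (f : {poly D}) :
  Spec Q -> ~ Q s -> map_poly (to_K D) f = to_K D s *: g ->
  content (localization (to_K D) (~` Q)) g = localization (to_K D) (~` Q) <->
  ~ polyset Q f.
Proof.
move=> QP Ns fE; have SM := compl_prime_mult_closed QP.
have [[Q0 QD QM] Q1 Qprime] := (SpecP Q).1 QP.
have Snz := compl_ideal_neq0 (@to_K_inj D) Q0.
have gE i : g`_i = to_K D f`_i / to_K D s.
  by rewrite -coef_map fE coefZ mulrC mulKf ?Snz.
set T := localization _ _; split => [cT Qf|Nf].
  (* P is the maximal ideal QD_Q. *)
  pose P := [set z | exists a s, [/\ Q a, ~ Q s & z = to_K D a / to_K D s]].
  have : content T g `<=` P.
    apply: prodset_min.
    - by exists 0, 1; rewrite rmorph0 mul0r.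
    - move=> _ _ [a [t [Qa Nt ->]]] [b [u [Qb Nu ->]]].
      exists (a * u + b * t), (t * u); split.
      + by apply: QD; rewrite mulrC; apply: QM.
      + by case/Qprime.
      + by rewrite addf_div ?Snz// rmorphD !rmorphM.
    - move=> _ _ [a [t [Nt ->]]] [i _ <-].
      exists (a * f`_i), (t * s); split; first exact/QM/Qf.
        by case/Qprime.
      by rewrite gE !rmorphM mulf_div.
  rewrite cT => /(_ 1)[|a [t [Qa Nt]]].
    by exists 1, 1; rewrite rmorph1 divr1.
  move=> /esym/(canRL (divfK (Snz _ Nt))); rewrite mul1r => /to_K_inj at_.
  by apply: Nt; rewrite -at_.
apply/seteqP; split.
  apply: prodset_min; first by rewrite -(rmorph0 (to_K D)); exact: localization_iota.
    by move=> x y Tx Ty; apply: localization_add.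
  move=> x _ Tx [i _ <-]; apply: localization_mul => //.
  by rewrite gE; exists f`_i, s.
move=> x Tx; have /existsNP[i Ni] : ~ forall i, Q f`_i by [].
(* This coefficient is a unit of D_Q, so x is a multiple of it. *)
have gi0 : g`_i != 0 by rewrite gE mulf_neq0 ?invr_eq0 ?Snz.
rewrite -(divfK gi0 x); apply: prodsetM; last by exists i.
apply: localization_mul => //; exists s, f`_i; split => //.
by rewrite gE invf_div.
Qed.

(** Compares a fraction with the one obtained by clearing the denominators of its two terms with
    different constants. *)
Lemma divf_cross (L : fieldType) (u v x y : L) :
  u != 0 -> v != 0 -> x / y = u * x * v / (v * y * u).
Proof.
move=> u0 v0; rewrite [u * x * v]mulrAC [v * y * u]mulrAC [v * u]mulrC.
by rewrite -mulf_div divff ?mulf_neq0 ?mul1r.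
Qed.

(** After denominators are cleared, the content condition says that the denominator is outside Q[X]:
    D_Q(X) is D[X] localized at the prime Q[X]. *)
Lemma Nagata_localization (D : idomainType) (Q : set D) :
  Spec Q ->
  Nagata (localization (to_K D) (~` Q)) =
  localization (to_K1 D) (~` polyset Q).
Proof.
move=> QP; have SM := compl_prime_mult_closed QP.
have [[Q0 _ _] Q1 _] := (SpecP Q).1 QP.
have Snz := compl_ideal_neq0 (@to_K_inj D) Q0.
have /SpecP[_ _ QXP] := polyset_prime QP.
apply/seteqP; split.
  move=> _ [f [g [Tf Tg cg ->]]].
  have [s [f' [Ns f'E]]] := polyset_localization SM Snz Tf.
  have [t [g' [Nt g'E]]] := polyset_localization SM Snz Tg.
  have Ng' := (content_localization QP Nt g'E).1 cg.
  exists (f' * t%:P), (g' * s%:P); split.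
    by case/QXP => // /(_ 0%N); rewrite coefC.
  rewrite /= !rmorphM /= !map_polyC /= f'E g'E -!mul_polyC !tofracM.
  have cst0 r : ~ Q r -> FracField.tofrac (to_K D r)%:P != 0.
    by move=> Nr; rewrite tofrac_eq0 polyC_eq0 Snz.
  by apply: divf_cross; apply: cst0.
move=> _ [f [g [Ng ->]]].
exists (map_poly (to_K D) f), (map_poly (to_K D) g); split => //.
- by move=> i; rewrite coef_map; apply: localization_iota.
- by move=> i; rewrite coef_map; apply: localization_iota.
- by apply/(@content_localization _ _ _ 1 g) => //; rewrite rmorph1 scale1r.
Qed.

(** * Semistar operations described through coefficients *)

(** The condition on z says that gz lies in A[Y] for some g in S; this is the intersection with K_1
    of the localization of A[Y] at S, without the field K_1(Y). *)
Definition coef_colon (R : idomainType) (L : fieldType)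
    (iota : {rmorphism R -> L}) (S : set {poly R}) (A : set L) : set L :=
  [set z | exists2 g, S g & forall i, A (iota g`_i * z)].

Lemma submodule_sum (R : idomainType) (L : fieldType)
    (iota : {rmorphism R -> L}) (A : set L) (T : Type) (r : seq T)
    (P : pred T) (F : T -> L) :
  submodule iota A -> (forall i, P i -> A (F i)) -> A (\sum_(i <- r | P i) F i).
Proof. by move=> [A0 AD _] AF; apply: (big_ind A). Qed.

(** The bound on i makes the condition finite in g, which is what the idempotence proof can
    supply. *)
Lemma coef_colonM (R : idomainType) (L : fieldType)
    (iota : {rmorphism R -> L}) (A : set L) (g h : {poly R}) (z : L) :
  submodule iota A ->
  (forall i j, (i < size g)%N -> A (iota (g`_i * h`_j) * z)) ->
  forall k, A (iota (g * h)`_k * z).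
Proof.
move=> AS gh k; rewrite coefM rmorph_sum mulr_suml.
apply: (submodule_sum _ AS) => i _; have [ig|gi] := ltnP i (size g).
  exact: gh.
by rewrite nth_default// mul0r rmorph0 mul0r; have [] := AS.
Qed.

Lemma coef_colonMl (R : idomainType) (L : fieldType)
    (iota : {rmorphism R -> L}) (A : set L) (g h : {poly R}) (z : L) :
  submodule iota A -> (forall i, A (iota g`_i * z)) ->
  forall k, A (iota (h * g)`_k * z).
Proof.
move=> AS gA; apply: coef_colonM => // i j _.
by rewrite rmorphM -mulrA; have [_ _ AM] := AS; apply: AM.
Qed.

Lemma coef_colonMr (R : idomainType) (L : fieldType)
    (iota : {rmorphism R -> L}) (A : set L) (g h : {poly R}) (z : L) :
  submodule iota A -> (forall i, A (iota g`_i * z)) ->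
  forall k, A (iota (g * h)`_k * z).
Proof. by rewrite mulrC; apply: coef_colonMl. Qed.

Lemma coef_colon_submodule (R : idomainType) (L : fieldType)
    (iota : {rmorphism R -> L}) (S : set {poly R}) (A : set L) :
  mult_closed S -> submodule iota A -> submodule iota (coef_colon iota S A).
Proof.
move=> [S1 SM] AS; have [A0 AD AM] := AS; split.
- by exists 1 => // i; rewrite mulr0.
- move=> x y [g Sg gx] [h Sh hy]; exists (g * h); first exact: SM.
  move=> i; rewrite mulrDr; apply: AD; first exact: coef_colonMr.
  exact: coef_colonMl.
- by move=> a x [g Sg gx]; exists g => // i; rewrite mulrCA; apply: AM.
Qed.

Lemma sub_coef_colon (R : idomainType) (L : fieldType)
    (iota : {rmorphism R -> L}) (S : set {poly R}) (A : set L) :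
  mult_closed S -> submodule iota A -> A `<=` coef_colon iota S A.
Proof.
move=> [S1 _] [A0 _ AM] x Ax; exists 1 => // i; rewrite coef1.
by case: (i == 0%N); [exact: AM|rewrite rmorph0 mul0r].
Qed.

Lemma coef_colon_mono (R : idomainType) (L : fieldType)
    (iota : {rmorphism R -> L}) (S T : set {poly R}) (A B : set L) :
  S `<=` T -> A `<=` B -> coef_colon iota S A `<=` coef_colon iota T B.
Proof. by move=> ST AB z [g Sg gz]; exists g; [exact: ST|move=> i; apply: AB]. Qed.

(** Each coefficient c of g comes with its own h_c in S such that h_c(cz) lies in A[Y]. The product
    of these finitely many h_c serves all coefficients, and g times that product is the witness. *)
Lemma coef_colon_idem (R : idomainType) (L : fieldType)
    (iota : {rmorphism R -> L}) (S : set {poly R}) (A : set L) :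
  mult_closed S -> submodule iota A ->
  coef_colon iota S (coef_colon iota S A) = coef_colon iota S A.
Proof.
move=> SC AS; have [S1 SM] := SC; apply/seteqP; split; last first.
  by apply: sub_coef_colon => //; apply: coef_colon_submodule.
move=> z [g Sg gz].
suff [h Sh hz] : exists2 h, S h &
    forall i, (i < size g)%N -> forall j, A (iota h`_j * (iota g`_i * z)).
  exists (g * h); first exact: SM.
  by apply: coef_colonM => // i j ig; rewrite [g`_i * _]mulrC rmorphM -mulrA; apply: hz.
elim: (size g) => [|n [h Sh hz]]; first by exists 1.
have [h' Sh' hz'] := gz n.
exists (h * h'); first exact: SM.
move=> i; rewrite ltnS leq_eqVlt => /predU1P[->|/hz hi].
  exact: coef_colonMl.
exact: coef_colonMr.
Qed.

Lemma coef_colon_semistar (R : idomainType) (L : fieldType)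
    (iota : {rmorphism R -> L}) (S : set {poly R}) :
  mult_closed S -> semistar iota (coef_colon iota S).
Proof.
move=> SC; split.
- move=> E [ES [e Ee e0]]; split; first exact: coef_colon_submodule.
  by exists e => //; apply: sub_coef_colon.
- move=> x E x0 [ES _]; apply/seteqP; split.
    move=> z [g Sg gz]; exists (x^-1 * z); last by rewrite mulVKf.
    exists g => // i; have [e Ee eE] := gz i.
    by rewrite mulrCA -eE mulKf.
  move=> _ [z [g Sg gz] <-]; exists g => // i; rewrite mulrCA.
  by exists (iota g`_i * z).
- by move=> E F _ _; apply: coef_colon_mono.
- by move=> E [ES _]; apply: sub_coef_colon.
- by move=> E [ES _]; apply: coef_colon_idem.
Qed.

Lemma coef_colon_stable (R : idomainType) (L : fieldType)
    (iota : {rmorphism R -> L}) (S : set {poly R}) :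
  mult_closed S -> stable iota (coef_colon iota S).
Proof.
move=> [_ SM] E F [ES _] [FS _]; apply/seteqP; split => z.
  by move=> [g Sg gz]; split; exists g => // i; have [] := gz i.
move=> [[g Sg gz] [h Sh hz]]; exists (g * h); first exact: SM.
by move=> i; split; [apply: coef_colonMr|apply: coef_colonMl].
Qed.

(** If g witnesses z, the finitely many products of z with the coefficients of g generate a
    submodule of E for which g still works. *)
Lemma coef_colon_finite_type (R : idomainType) (L : fieldType)
    (iota : {rmorphism R -> L}) (S : set {poly R}) :
  injective iota -> mult_closed S -> ~ S 0 ->
  finite_type iota (coef_colon iota S).
Proof.
move=> iinj SC S0 E [ES [e Ee e0]]; apply/seteqP; split; last first.
  by move=> z [F [_ FE]]; apply: coef_colon_mono.
move=> z [g Sg gz]; have [->|z0] := eqVneq z 0.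
  exists (fgspan iota [:: e]); first split.
  - by apply: (@Ffg_fgspan _ _ _ _ e); rewrite ?mem_head.
  - by apply: fgspan_min => // x; rewrite inE => /eqP->.
  - by have [] := coef_colon_submodule SC (fgspan_submodule iota [:: e]).
have g0 : g != 0 by apply/eqP => g0; apply: S0; rewrite -g0.
set s := [seq iota c * z | c <- g].
(* The leading coefficient provides a nonzero generator. *)
have lead_s : iota (lead_coef g) * z \in s.
  apply/mapP; exists (lead_coef g) => //.
  by rewrite mem_nth// prednK// lt0n size_poly_eq0.
exists (fgspan iota s); first split.
- apply: (@Ffg_fgspan _ _ iota _ _ lead_s).
  by rewrite mulf_neq0// rmorph_inj_eq0// lead_coef_eq0.
- by apply: fgspan_min => // _ /mapP[c /(nthP 0)[i _ <-] ->].
- exists g => // i; have [ig|gi] := ltnP i (size g).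
    by apply/mem_fgspan/mapP; exists g`_i => //; rewrite mem_nth.
  rewrite nth_default// raddf0 mul0r.
  by have [] := fgspan_submodule iota s.
Qed.

(** This transfer and the two similar ones below carry properties from [coef_colon] to
    [star_of_set]. Agreement is assumed on all submodules, zero included, which covers intersections
    directly. *)
Lemma semistar_congr (R : idomainType) (L : fieldType)
    (iota : {rmorphism R -> L}) (star star' : set L -> set L) :
  (forall E, submodule iota E -> star E = star' E) ->
  semistar iota star -> semistar iota star'.
Proof.
move=> eqs [sF sscale smono sext sidem]; split.
- by move=> E EF; rewrite -eqs; [exact: sF|case: EF].
- move=> x E x0 EF; have [ES _] := EF.
  by rewrite -!eqs// ?sscale//; apply: scale_submodule.
- move=> E F EF FF; have [ES _] := EF; have [FS _] := FF.
  by rewrite -!eqs//; apply: smono.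
- by move=> E EF; rewrite -eqs; [exact: sext|case: EF].
- move=> E EF; have [ES _] := EF; have [sES _] := sF _ EF.
  by rewrite -eqs -?eqs// sidem.
Qed.

Lemma submoduleI (R : idomainType) (L : fieldType)
    (iota : {rmorphism R -> L}) (E F : set L) :
  submodule iota E -> submodule iota F -> submodule iota (E `&` F).
Proof.
move=> [E0 ED EM] [F0 FD FM]; split => //.
- by move=> x y [Ex Fx] [Ey Fy]; split; [apply: ED|apply: FD].
- by move=> a x [Ex Fx]; split; [apply: EM|apply: FM].
Qed.

Lemma stable_congr (R : idomainType) (L : fieldType)
    (iota : {rmorphism R -> L}) (star star' : set L -> set L) :
  (forall E, submodule iota E -> star E = star' E) ->
  stable iota star -> stable iota star'.
Proof.
move=> eqs sst E F EF FF; have [ES _] := EF; have [FS _] := FF.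
by rewrite -!eqs ?sst//; apply: submoduleI.
Qed.

Lemma finite_type_congr (R : idomainType) (L : fieldType)
    (iota : {rmorphism R -> L}) (star star' : set L -> set L) :
  (forall E, submodule iota E -> star E = star' E) ->
  finite_type iota star -> finite_type iota star'.
Proof.
move=> eqs sft E EF; have [ES _] := EF; rewrite -eqs// sft//.
by apply: eq_bigcupr => F [/Ffg_Fbar[FS _] _]; rewrite eqs.
Qed.

(** For a constant z of K_1(Y), the coefficients of gz are the g_i z, and AD_1[Y] = A[Y] is
    recognized on coefficients. *)
Lemma star_of_set_coef_colon (D : idomainType) (S : set {poly {poly D}})
    (A : set (ratfun {fraction D})) :
  mult_closed S -> ~ S 0 -> submodule (to_K1 D) A ->
  coef_colon (to_K1 D) S A = star_of_set S A.
Proof.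
move=> SC S0 [A0 AD AM].
have Snz g : S g -> to_K1Y D g != 0.
  move=> Sg; rewrite tofrac_eq0 -(rmorph0 (map_poly (to_K1 D))).
  rewrite (inj_eq (map_inj_poly (@to_K1_inj D) (rmorph0 _))).
  by apply/eqP => g0; apply: S0; rewrite -g0.
apply/seteqP; split => z.
  move=> [g Sg gz]; apply/(prodset_localization _ _ SC Snz); exists g => //.
  have -> : to_K1Y D g * cstY _ z =
      \sum_(i < size g) cstY _ (to_K1 D g`_i * z) * to_K1Y D 'X^i.
    under eq_bigr do rewrite /= map_polyXn -tofracM mul_polyC.
    rewrite /= -tofracM -(rmorph_sum (@FracField.tofrac _)).
    congr FracField.tofrac; rewrite -(poly_def _ (fun i => to_K1 D g`_i * z)).
    apply/polyP => i; rewrite coefMC coef_map coef_poly.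
    by case: ltnP => // gi; rewrite nth_default// raddf0 mul0r.
  elim/big_ind: _ => [|x y|i _]; [exact: prodset0|exact: prodsetD|].
  by apply: prodsetM; [exists (to_K1 D g`_i * z)|exists 'X^i].
move=> /(prodset_localization _ _ SC Snz)[g Sg gz]; exists g => //.
(* This set is A[Y] inside K_1(Y). *)
have : [set w | exists2 p : {poly ratfun {fraction D}},
      w = FracField.tofrac p & forall i, A p`_i]
    (to_K1Y D g * cstY _ z).
  move: gz; apply: prodset_min.
  - by exists 0 => [|i]; rewrite ?rmorph0 ?coef0.
  - move=> _ _ [p -> Ap] [q -> Aq]; exists (p + q); first by rewrite rmorphD.
    by move=> i; rewrite coefD; apply: AD.
  - move=> _ _ [a Aa <-] [h _ <-].
    exists (a%:P * map_poly (to_K1 D) h); first by rewrite rmorphM.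
    by move=> i; rewrite coefCM coef_map mulrC; apply: AM.
move=> [p /eqP]; rewrite -tofracM tofrac_eq => /eqP pE Ap i.
by have := Ap i; rewrite -pE coefMC coef_map.
Qed.

(** * Centers, and ideals contained in none or in one of them *)

(* The zero ideal replaces an empty QMax: its localization is K. *)
Definition centers (D : idomainType)
    (star : set {fraction D} -> set {fraction D}) : set (set D) :=
  QMax (to_K D) (star_f (to_K D) star)
  `|` [set Q | QMax (to_K D) (star_f (to_K D) star) = set0 /\ Q = [set 0]].

Lemma loc_overringsE (D : idomainType)
    (star : set {fraction D} -> set {fraction D}) :
  loc_overrings star =
  [set localization (to_K D) (~` Q) | Q in centers star].
Proof.
apply/seteqP; split => T.
  move=> [[Q QP ->]|[QM0 ->]]; first by exists Q => //; left.
  by exists [set 0]; [right|exact: localization_setC0].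
move=> [Q [QP|[QM0 ->]] <-]; [left; by exists Q|right; split => //].
exact: localization_setC0.
Qed.

Lemma set0_Spec (R : idomainType) : Spec [set 0 : R].
Proof.
apply/SpecP; split.
- split => [//|x y -> ->|a x ->]; first by rewrite /= addr0.
  by rewrite /= mulr0.
- by move=> /eqP; rewrite oner_eq0.
- by move=> x y /eqP; rewrite mulf_eq0 => /orP[]/eqP; auto.
Qed.

Lemma center_prime (D : idomainType)
    (star : set {fraction D} -> set {fraction D}) (Q : set D) :
  semistar (to_K D) star -> centers star Q -> Spec Q.
Proof.
move=> sstar [|[_ ->]]; last exact: set0_Spec.
by apply: QMax_prime => //; exact: to_K_inj.
Qed.

Lemma ideal_nonzero (R : nzRingType) (I : set R) :
  is_ideal I -> I = [set 0] \/ nonzero_set I.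
Proof.
move=> [I0 _ _]; have [[x [Ix x0]]|I00] := pselect (exists x, I x /\ x != 0).
  by right; exists x.
left; apply/seteqP; split => [x Ix|_ ->//].
by apply: contrapT => /eqP x0; apply: I00; exists x.
Qed.

(** If QMax is nonempty, then 1 is in I^{star_f}, since otherwise some Q in QMax would contain I.
    The generators of a finitely generated F inside I with 1 in F^star cannot all lie in one Q, as 1
    is outside Q^{star_f}. If QMax is empty, one nonzero element of I suffices. *)
Lemma centers_finite (D : idomainType)
    (star : set {fraction D} -> set {fraction D}) (I : set D) :
  semistar (to_K D) star -> is_ideal I ->
  (forall Q, centers star Q -> exists2 x, I x & ~ Q x) ->
  exists2 s : seq D, (forall x, x \in s -> I x) &
    forall Q, centers star Q -> exists2 x, x \in s & ~ Q x.
Proof.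
move=> sstar II IN.
have [QM0|/set0P[Q0 Q0M]] := eqVneq (QMax (to_K D) (star_f (to_K D) star)) set0.
  have [|x Ix x0] := IN [set 0]; first by right.
  exists [:: x]; first by move=> y; rewrite inE => /eqP->.
  move=> Q [|[_ ->]]; first by rewrite QM0.
  by exists x; rewrite ?mem_head.
have INz : nonzero_set I.
  have [I0|//] := ideal_nonzero II.
  have [|x] := IN Q0; first by left.
  have /SpecP[[Q00 _ _] _ _] := center_prime sstar (or_introl Q0M : centers star Q0).
  by rewrite I0 => ->.
have [[F [[F0 [s FE]] FI] F1]|/(QMax_above (@to_K_inj D) sstar II INz)[Q QM IQ]] :=
    pselect (star_f (to_K D) star (to_K D @` I) 1); last first.
  by have [|x Ix] := IN Q; [left|move=> /(_ (IQ x Ix))].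
have [|t sE tI] := @seq_image _ _ (to_K D) I s.
  by move=> y ys; apply: FI; rewrite FE; apply: mem_fgspan.
exists t => // Q [QM|[QM0 _]]; last by rewrite QM0 in Q0M.
apply: contrapT => Nt; apply: (QMax_star_f1 QM); exists F => //; split.
  by split => //; exists s.
have /SpecP[QI _ _] := center_prime sstar (or_introl QM : centers star Q).
rewrite FE; apply: fgspan_min; first exact: range_submodule.
move=> y; rewrite sE => /mapP[x xt ->]; exists x => //.
by apply: contrapT => Nx; apply: Nt; exists x.
Qed.

Lemma range_Fbar (D : idomainType) : Fbar (to_K D) (range (to_K D)).
Proof.
by apply: image_Fbar; [exact: to_K_inj|split|exists 1; rewrite ?oner_neq0].
Qed.

(** D is generated by 1. This reconciles D^{star_f} in [Delta1] with D^star in [Delta1']. *)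
Lemma star_f_range (D : idomainType)
    (star : set {fraction D} -> set {fraction D}) :
  semistar (to_K D) star ->
  star_f (to_K D) star (range (to_K D)) = star (range (to_K D)).
Proof.
move=> [_ _ smono _ _]; apply/seteqP; split.
  move=> x [F [FF Fsub] Fx]; apply: smono Fx => //; last exact: range_Fbar.
  exact: Ffg_Fbar.
move=> x sx; exists (range (to_K D)) => //; split => //; split.
  by have [] := range_Fbar D.
exists [:: 1]; apply/seteqP; split.
  by move=> _ [a _ <-]; rewrite -[to_K D a]mulr1; apply: prodsetM;
    [exists a|rewrite /= mem_head].
apply: fgspan_min; first by have [] := range_Fbar D.
by move=> y; rewrite inE => /eqP->; exists 1; rewrite ?rmorph1.
Qed.

(** For nonzero P, the strict inclusion amounts to 1 being outside P^{star_f}, and [QMax_above] then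
    gives Q. The zero ideal lies in every center and is the only center when QMax is empty. *)
Lemma sub_centerP (D : idomainType)
    (star : set {fraction D} -> set {fraction D}) (P : set D) :
  semistar (to_K D) star -> is_ideal P ->
  (P = [set 0] \/ star_f (to_K D) star (to_K D @` P)
     `<` star_f (to_K D) star (range (to_K D))) <->
  exists2 Q, centers star Q & P `<=` Q.
Proof.
move=> sstar PI; split.
  have [P0 _|Pnz] := ideal_nonzero PI.
    have [QM0|/set0P[Q QM]] :=
        eqVneq (QMax (to_K D) (star_f (to_K D) star)) set0.
      by exists [set 0]; [right|rewrite P0].
    exists Q; first by left.
    have /SpecP[[Q0 _ _] _ _] := center_prime sstar (or_introl QM : centers star Q).
    by rewrite P0 => _ ->.
  have [P1|/(QMax_above (@to_K_inj D) sstar PI Pnz)[Q QM PQ] _] :=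
      pselect (star_f (to_K D) star (to_K D @` P) 1); last first.
    by exists Q => //; left.
  case=> [P0|[_ Nsub]].
    by case: Pnz => x; rewrite P0 => ->; rewrite eqxx.
  (* If 1 is in the submodule P^{star_f}, that submodule contains D, hence D^{star_f}. *)
  case: Nsub; apply: star_f_idem => //.
    by apply: image_Fbar => //; exact: to_K_inj.
  have PF : Fbar (to_K D) (to_K D @` P) by apply: image_Fbar => //; exact: to_K_inj.
  move=> _ [a _ <-]; rewrite -[to_K D a]mulr1.
  by have [_ _ SM] := star_f_submodule sstar PF; apply: SM.
move=> [Q [QM|[QM0 ->]] PQ]; last first.
  left; apply/seteqP; split => // _ ->; by have [] := PI.
right; split; first by apply: star_f_mono => _ [x _ <-]; exists x.
move=> /(_ 1) sub; apply: (QMax_star_f1 QM).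
apply: (@star_f_mono _ _ _ _ (to_K D @` P)); first exact: image_subset.
by apply/sub; apply: sub_star_f => //; exact: range_Fbar.
Qed.

(** * The prime families of D[X] and their multiplicative sets *)

Lemma contraction_ideal (D : idomainType) (Q : set {poly D}) :
  is_ideal Q -> is_ideal (contraction Q).
Proof.
move=> [Q0 QD QM]; split; first exact: Q0.
  by move=> x y Qx Qy; rewrite /contraction /= polyCD; apply: QD.
by move=> a x Qx; rewrite /contraction /= polyCM; apply: QM.
Qed.

Lemma contraction_polyset (D : idomainType) (Q : set D) :
  Q 0 -> contraction (polyset Q) = Q.
Proof.
move=> Q0; apply/seteqP; split => d; first by move=> /(_ 0%N); rewrite coefC.
by move=> Qd i; rewrite coefC; case: ifP.
Qed.

Lemma Delta1P (D : idomainType) (star : set {fraction D} -> set {fraction D})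
    (Q1 : set {poly D}) :
  semistar (to_K D) star ->
  Delta1 star Q1 <->
  Spec Q1 /\ exists2 Q, centers star Q & contraction Q1 `<=` Q.
Proof.
move=> sstar; split=> -[Q1S]; have /SpecP[Q1I _ _] := Q1S;
  by have h := sub_centerP sstar (contraction_ideal Q1I); move/h.
Qed.

Lemma Delta1'P (D : idomainType) (star : set {fraction D} -> set {fraction D})
    (Q1 : set {poly D}) :
  semistar (to_K D) star ->
  Delta1' star Q1 <->
  Spec Q1 /\ (contraction Q1 = [set 0] \/
    (Q1 = polyset (contraction Q1) /\
     exists2 Q, centers star Q & contraction Q1 `<=` Q)).
Proof.
move=> sstar; rewrite /Delta1' /= -star_f_range//.
split=> -[Q1S]; have /SpecP[Q1I _ _] := Q1S;
  have h := sub_centerP sstar (contraction_ideal Q1I).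
- move=> [c0|[Q1E lt]]; split => //; [by left|right; split => //].
  by apply/h; right.
- move=> [c0|[Q1E /h[c0|lt]]]; split => //; [by left|by left|by right].
Qed.

Lemma Delta1'_sub (D : idomainType)
    (star : set {fraction D} -> set {fraction D}) :
  semistar (to_K D) star -> Delta1' star `<=` Delta1 star.
Proof.
move=> sstar Q1 [Q1S [c0|[_ lt]]]; split => //; first by left.
by right; rewrite star_f_range.
Qed.

(** Keeps 0 out of the multiplicative set of [Delta1'] and, through [Delta1'_sub], out of that of
    [Delta1]. *)
Lemma set0_Delta1' (D : idomainType)
    (star : set {fraction D} -> set {fraction D}) : Delta1' star [set 0].
Proof.
split; first exact: set0_Spec.
left; apply/seteqP; split => d; rewrite /contraction /=.
  by move=> /eqP; rewrite polyC_eq0 => /eqP.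
by move=> ->.
Qed.

Lemma mult_setP (D : idomainType) (Delta : set (set {poly D}))
    (g : {poly {poly D}}) :
  mult_set Delta g <-> forall Q1, Delta Q1 -> exists i, ~ Q1 g`_i.
Proof.
split=> [Ng Q1 Q1D|gD [Q1 Q1D gQ1]].
  by apply/existsNP => gQ1; apply: Ng; exists Q1.
by have [i] := gD _ Q1D; apply.
Qed.

Lemma mult_set_closed (D : idomainType) (Delta : set (set {poly D})) :
  Delta `<=` @Spec {poly D} -> mult_closed (mult_set Delta).
Proof.
move=> DS; split.
  by move=> [Q /DS/polyset_prime/SpecP[_ Q1 _]].
move=> g h Ng Nh [Q QD gh].
have /SpecP[_ _ QP] := polyset_prime (DS _ QD).
by case: (QP _ _ gh) => ?; [apply: Ng|apply: Nh]; exists Q.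
Qed.

Lemma mult_set0 (D : idomainType) (Delta : set (set {poly D})) :
  Delta [set 0] -> ~ mult_set Delta 0.
Proof. by move=> D0; apply; exists [set 0] => // i; rewrite coef0. Qed.

(** * Membership in terms of the colon ideal *)

(** The ideal J = (A :_{D[X]} z). *)
Definition colon1 (D : idomainType) (A : set (ratfun {fraction D}))
  (z : ratfun {fraction D}) : set {poly D} := [set f | A (to_K1 D f * z)].

Lemma colon1_ideal (D : idomainType) (A : set (ratfun {fraction D}))
    (z : ratfun {fraction D}) :
  submodule (to_K1 D) A -> is_ideal (colon1 A z).
Proof.
move=> [A0 AD AM]; split; rewrite /colon1 /mkset.
- by rewrite (rmorph0 (to_K1 D)) mul0r.
- by move=> x y Ax Ay; rewrite (rmorphD (to_K1 D)) mulrDl; apply: AD.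
- by move=> a x Ax; rewrite (rmorphM (to_K1 D)) -mulrA; apply: AM.
Qed.

Lemma prodset_localization1 (D : idomainType) (A : set (ratfun {fraction D}))
    (S : set {poly D}) (z : ratfun {fraction D}) :
  submodule (to_K1 D) A -> mult_closed S -> ~ S 0 ->
  prodset A (localization (to_K1 D) S) z <-> colon1 A z `&` S !=set0.
Proof.
move=> AS SC S0; have Snz s : S s -> to_K1 D s != 0.
  move=> Ss; rewrite (rmorph_inj_eq0 _ (@to_K1_inj D)).
  by apply/eqP => s0; apply: S0; rewrite -s0.
have h := prodset_localization A z SC Snz; rewrite prodset_range// in h.
split; first by move=> /h[s Ss Az]; exists s.
by move=> [s [Az Ss]]; apply/h; exists s.
Qed.

Lemma image_polyC_mult_closed (D : idomainType) (Q : set D) :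
  Spec Q -> mult_closed [set d%:P | d in ~` Q].
Proof.
move=> /compl_prime_mult_closed[S1 SM]; split; first by exists 1.
move=> _ _ [x Nx <-] [y Ny <-]; exists (x * y); first exact: SM.
by rewrite polyCM.
Qed.

Lemma prodset_poly_ext (D : idomainType) (A : set (ratfun {fraction D}))
    (Q : set D) (z : ratfun {fraction D}) :
  submodule (to_K1 D) A -> Spec Q ->
  prodset A (poly_ext (localization (to_K D) (~` Q))) z <->
  exists2 d, ~ Q d & colon1 A z d%:P.
Proof.
move=> AS QP; rewrite poly_ext_localization//.
have SC := image_polyC_mult_closed QP.
have S0 : ~ [set d%:P | d in ~` Q] 0.
  move=> [d Nd /eqP]; rewrite polyC_eq0 => /eqP d0; apply: Nd.
  by have /SpecP[[Q0 _ _] _ _] := QP; rewrite d0.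
have h := prodset_localization1 z AS SC S0; split.
  by move=> /h[f [Az [d Nd dE]]]; exists d; rewrite ?dE.
by move=> [d Nd Az]; apply/h; exists d%:P; split => //; exists d.
Qed.

Lemma prodset_Nagata (D : idomainType) (A : set (ratfun {fraction D}))
    (Q : set D) (z : ratfun {fraction D}) :
  submodule (to_K1 D) A -> Spec Q ->
  prodset A (Nagata (localization (to_K D) (~` Q))) z <->
  exists2 f, colon1 A z f & ~ polyset Q f.
Proof.
move=> AS QP; rewrite Nagata_localization//.
have QXP := polyset_prime QP.
have S0 : ~ (~` polyset Q) 0 by apply; have /SpecP[[]] := QXP.
have h := prodset_localization1 z AS (compl_prime_mult_closed QXP) S0; split.
  by move=> /h[f [Az Nf]]; exists f.
by move=> [f Az Nf]; apply/h; exists f.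
Qed.

Lemma bracket_tildeP (D : idomainType)
    (star : set {fraction D} -> set {fraction D})
    (A : set (ratfun {fraction D})) (z : ratfun {fraction D}) :
  semistar (to_K D) star -> submodule (to_K1 D) A ->
  bracket_tilde star A z <->
  forall Q, centers star Q -> exists2 d, ~ Q d & colon1 A z d%:P.
Proof.
move=> sstar AS; rewrite /bracket_tilde loc_overringsE; split.
  move=> Bz Q QC; apply/(prodset_poly_ext _ AS (center_prime sstar QC)).
  by apply: Bz; exists Q.
move=> Bz _ [Q QC <-].
exact/(prodset_poly_ext _ AS (center_prime sstar QC))/Bz.
Qed.

Lemma angle_tildeP (D : idomainType)
    (star : set {fraction D} -> set {fraction D})
    (A : set (ratfun {fraction D})) (z : ratfun {fraction D}) :
  semistar (to_K D) star -> submodule (to_K1 D) A ->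
  angle_tilde star A z <->
  (forall Q, centers star Q -> exists2 f, colon1 A z f & ~ polyset Q f) /\
  exists2 d, d != 0 & colon1 A z d%:P.
Proof.
(* K is the localization of D at (0), so AK[X] is handled as AD_Q[X] with Q = (0). *)
move=> sstar AS; rewrite /angle_tilde loc_overringsE -localization_setC0.
have h0 := prodset_poly_ext z AS (set0_Spec D); split.
  move=> [Bz /h0[d /eqP d0 Az]]; split; last by exists d.
  move=> Q QC; apply/(prodset_Nagata _ AS (center_prime sstar QC)).
  by apply: Bz; exists Q.
move=> [Bz [d /eqP d0 Az]]; split; last by apply/h0; exists d.
move=> _ [Q QC <-].
exact/(prodset_Nagata _ AS (center_prime sstar QC))/Bz.
Qed.

(** * Comparison with the bracket and angle operations *)

Lemma coef_colon_Delta1 (D : idomainType)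
    (star : set {fraction D} -> set {fraction D})
    (A : set (ratfun {fraction D})) :
  semistar (to_K D) star -> submodule (to_K1 D) A ->
  bracket_tilde star A =
  coef_colon (to_K1 D) (mult_set (Delta1 star)) A.
Proof.
move=> sstar AS; apply/seteqP; split => z.
  move=> /(bracket_tildeP _ sstar AS) Bz.
  (* Finiteness is applied to J ∩ D; the elements found, as constants of D[X], become the
     coefficients of g. *)
  have [|s sI sN] := centers_finite sstar (contraction_ideal (colon1_ideal z AS)).
    by move=> Q /Bz[d Nd Az]; exists d.
  exists (Poly (map polyC s)); last first.
    move=> i; rewrite coef_Poly; have [is_|si] := ltnP i (size s).
      by rewrite (nth_map 0)//; apply/sI/mem_nth.
    rewrite nth_default ?size_map//.
    by have [] := colon1_ideal z AS.
  apply/mult_setP => Q1 /(Delta1P _ sstar)[_ [Q QC Q1Q]].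
  have [x xs Nx] := sN _ QC; exists (index x s).
  rewrite coef_Poly (nth_map 0) ?index_mem// nth_index// => Q1x.
  exact/Nx/Q1Q.
move=> [g /mult_setP gS gz]; apply/(bracket_tildeP _ sstar AS) => Q QC.
apply: contrapT => NQ; have QP := center_prime sstar QC.
(* If J misses D \ Q, a prime containing J and contracting into Q belongs to [Delta1], yet it
   contains all coefficients of g. *)
have [|Q1 [Q1P JQ1 Q1Q]] := prime_avoiding (colon1_ideal z AS)
    (image_polyC_mult_closed QP).
  rewrite -subset0 => f [Af [d Nd dE]]; apply: NQ; exists d => //.
  by rewrite dE.
have [|i] := gS Q1; last by apply; apply: JQ1; apply: gz.
apply/(Delta1P _ sstar); split => //; exists Q => // d Q1d.
apply: contrapT => Nd.
by have : (Q1 `&` [set d%:P | d in ~` Q]) d%:P by [split => //; exists d]; rewrite Q1Q.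
Qed.

(* Multiplication by powers of X aligns two coefficients, so the coefficients
   of the elements of an ideal are closed under sums. *)
Lemma coef_ideal (R : comNzRingType) (J : set {poly R}) :
  is_ideal J -> is_ideal [set c | exists2 f, J f & exists i, c = f`_i].
Proof.
move=> [J0 JD JM]; split.
- by exists 0 => //; exists 0%N; rewrite coef0.
- move=> _ _ [f Jf [i ->]] [g Jg [j ->]].
  exists ('X^j * f + 'X^i * g); first by apply: JD; apply: JM.
  exists (i + j)%N; rewrite coefD !coefXnM.
  by rewrite !ltnNge leq_addl leq_addr /= addnK addKn.
- move=> a _ [f Jf [i ->]]; exists (a%:P * f); first exact: JM.
  by exists i; rewrite coefCM.
Qed.

Lemma coef_colon_Delta1' (D : idomainType)
    (star : set {fraction D} -> set {fraction D})
    (A : set (ratfun {fraction D})) :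
  semistar (to_K D) star -> submodule (to_K1 D) A ->
  coef_colon (to_K1 D) (mult_set (Delta1' star)) A = angle_tilde star A.
Proof.
move=> sstar AS; apply/seteqP; split => z.
  move=> [g /mult_setP gS gz]; apply/(angle_tildeP _ sstar AS); split.
    move=> Q QC; have QP := center_prime sstar QC.
    have /SpecP[[Q0 _ _] _ _] := QP.
    (* Q[X] is itself a member of [Delta1']. *)
    have [|i Ni] := gS (polyset Q); last by exists g`_i => //; apply: gz.
    apply/(Delta1'P _ sstar); split; first exact: polyset_prime.
    by right; rewrite contraction_polyset//; split => //; exists Q.
  apply: contrapT => N0.
  (* If J has no nonzero constant, some prime containing J contracts to (0) and so belongs to
     [Delta1']. *)
  have [|Q1 [Q1P JQ1 Q10]] := prime_avoiding (colon1_ideal z AS)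
      (image_polyC_mult_closed (set0_Spec D)).
    rewrite -subset0 => f [Af [d /eqP d0 dE]]; apply: N0; exists d => //.
    by rewrite dE.
  have [|i] := gS Q1; last by apply; apply: JQ1; apply: gz.
  apply/(Delta1'P _ sstar); split => //; left.
  have /SpecP[/contraction_ideal[Q1z _ _] _ _] := Q1P.
  apply/seteqP; split => [d Q1d|_ ->//]; apply: contrapT => Nd.
  by have : (Q1 `&` [set d%:P | d in ~` [set 0]]) d%:P by [split => //; exists d];
    rewrite Q10.
move=> /(angle_tildeP _ sstar AS)[Bz [d d0 Az]].
have JI := colon1_ideal z AS.
(* Here finiteness is applied to the ideal of D formed by the coefficients of all elements of J; t
   then collects elements of J in which the chosen coefficients occur. *)
have [|s sI sN] := centers_finite sstar (coef_ideal JI).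
  move=> Q /Bz[f Jf /existsNP[i Ni]]; exists f`_i => //.
  by exists f => //; exists i.
have [t tJ ts] : exists2 t : seq {poly D}, (forall f, f \in t -> colon1 A z f) &
    forall x, x \in s -> exists2 f, f \in t & exists i, x = f`_i.
  elim: s sI {sN} => [|a s IH] sI; first by exists [::].
  have [|t tJ ts] := IH; first by move=> x xs; apply: sI; rewrite inE xs orbT.
  have [f Jf [i aE]] := sI a (mem_head _ _).
  exists (f :: t); first by move=> h; rewrite inE => /predU1P[->|/tJ].
  move=> x; rewrite inE => /predU1P[->|/ts[h ht hx]].
    by exists f; [rewrite mem_head|exists i].
  by exists h => //; rewrite inE ht orbT.
have coef_t f : f \in d%:P :: t -> exists i, f = (Poly (d%:P :: t))`_i.
  by move=> ft; exists (index f (d%:P :: t)); rewrite coef_Poly nth_index.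
(* The coefficient d escapes the primes contracting to (0), and those from t escape the primes P[X]
   with P inside a center. *)
exists (Poly (d%:P :: t)); last first.
  move=> i; rewrite coef_Poly; have [it|ti] := ltnP i (size (d%:P :: t)).
    have := mem_nth 0 it; rewrite inE => /predU1P[->//|]; exact: tJ.
  by rewrite nth_default//; have [] := JI.
apply/mult_setP => Q1 /(Delta1'P _ sstar)[_ [c0|[Q1E [Q QC Q1Q]]]].
  have [i dE] := coef_t d%:P (mem_head _ _); exists i; rewrite -dE => Q1d.
  have : contraction Q1 d by [].
  by rewrite c0 => /= d00; rewrite d00 eqxx in d0.
have [x xs Nx] := sN _ QC; have [f ft [j xE]] := ts _ xs.
have [|i fE] := coef_t f; first by rewrite inE ft orbT.
exists i; rewrite -fE Q1E => /(_ j) cfj; apply: Nx; rewrite xE; exact: Q1Q.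
Qed.

Lemma star_of_set_spec (D : idomainType) (Delta : set (set {poly D})) :
  Delta `<=` @Spec {poly D} -> Delta [set 0] ->
  [/\ semistar (to_K1 D) (star_of_set (mult_set Delta)),
      stable (to_K1 D) (star_of_set (mult_set Delta))
    & finite_type (to_K1 D) (star_of_set (mult_set Delta))].
Proof.
move=> DS D0; have SC := mult_set_closed DS; have S0 := mult_set0 D0.
have eqs A := @star_of_set_coef_colon D _ A SC S0.
split.
- exact: semistar_congr eqs (coef_colon_semistar _ SC).
- exact: (stable_congr eqs (coef_colon_stable SC)).
- exact: (finite_type_congr eqs (coef_colon_finite_type (@to_K1_inj D) SC S0)).
Qed.

Theorem proposition21 (D : idomainType)
    (star : set {fraction D} -> set {fraction D})
    (star_semistar : semistar (to_K D) star) :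
  [/\ semistar (to_K1 D) (star1 star), stable (to_K1 D) (star1 star)
    & finite_type (to_K1 D) (star1 star)] /\
  [/\ semistar (to_K1 D) (star1' star), stable (to_K1 D) (star1' star)
    & finite_type (to_K1 D) (star1' star)] /\
  (semistar_eq (to_K1 D) (bracket_tilde star) (star1 star) /\
   semistar_le (to_K1 D) (star1 star) (star1' star)) /\
  semistar_eq (to_K1 D) (star1' star) (angle_tilde star).
Proof.
have Delta_sub := Delta1'_sub star_semistar.
have D0' := set0_Delta1' star; have D0 := Delta_sub _ D0'.
have DS : Delta1 star `<=` @Spec {poly D} by move=> Q [].
have DS' : Delta1' star `<=` @Spec {poly D} by move=> Q [].
have eq1 A := @star_of_set_coef_colon D _ A (mult_set_closed DS) (mult_set0 D0).
have eq1' A :=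
  @star_of_set_coef_colon D _ A (mult_set_closed DS') (mult_set0 D0').
split; first exact: star_of_set_spec.
split; first exact: star_of_set_spec.
split; first split.
- by move=> A [AS _]; rewrite /star1 -eq1// coef_colon_Delta1.
- move=> A [AS _]; rewrite /star1 /star1' -eq1// -eq1'//.
  (* Fewer primes in [Delta1'] leave a larger multiplicative set. *)
  apply: coef_colon_mono => //; apply: subsetC.
  by move=> g [Q /Delta_sub QD Qg]; exists Q.
- by move=> A [AS _]; rewrite /star1' -eq1'// coef_colon_Delta1'.
Qed.
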